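(* Let $p$ be an odd prime, $n\ge 1$, $i\ge 1$. For all $m\ge 1$ and all $0\le s<n$, $(\mathrm{St}^{\Delta_i})^{m}(Q_{n,s})$ belongs to the principal ideal $(Q_{n,0}^{\,m})$ of $D_n$. Moreover, $(\mathrm{St}^{\Delta_i})^{m}(Q_{n,s})=0$ for all $m\ge p$ and all $0\le s<n$. In fact the operator identity $(\mathrm{St}^{\Delta_i})^p=0$ holds on $D_n$. Consequently $(\mathrm{St}^{\Delta_i})^m=0$ on $D_n$ for every $m\ge p$.
   Context: Let $p$ be an odd prime, $n\ge 1$, $i\ge 1$, and $P_n=\mathbb{F}_p[x_1,\dots,x_n]$. For integers $e_1,\dots,e_n\ge 0$ put $[e_1,\dots,e_n]:=\det\big(x_r^{p^{e_s}}\big)_{1\le r,s\le n}\in P_n$. Let $L_n=[0,1,\dots,n-1]$ and $L_{n,s}=[0,1,\dots,\widehat{s},\dots,n]$ for $0\le s<n$ (a hat means omission). The Dickson invariants are $Q_{n,s}=L_{n,s}/L_n$ $(0\le s<n)$; in particular $Q_{n,0}=L_n^{p-1}$. The Dickson algebra is $D_n=P_n^{\mathrm{GL}_n(\mathbb{F}_p)}=\mathbb{F}_p[Q_{n,0},\dots,Q_{n,n-1}]$, a polynomial algebra on these generators. $\mathrm{St}^{\Delta_i}$ denotes the Steenrod--Milnor operation dual to the monomial $\xi_i$ in Milnor's dual mod-$p$ Steenrod algebra. It acts on $P_n$ as the unique $\mathbb{F}_p$-linear derivation with $\mathrm{St}^{\Delta_i}(x_r)=x_r^{p^i}$ $(1\le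 r\le n)$, and it maps $D_n$ into $D_n$. Powers of operators denote iterated composition. *)

(* Defs.v *)
From HB Require Import structures.
From mathcomp Require Import all_boot all_order all_algebra all_fingroup.
From mathcomp Require Import mpoly.

Set Implicit Arguments.
Unset Strict Implicit.
Unset Printing Implicit Defensive.

Import GRing.Theory.
Local Open Scope ring_scope.

(* [P p n] is F_p[x_1, ..., x_n], with x_r written 'X_(r-1); ['F_p] is the     *)
(* field with p elements only when p is prime.                                 *)
Notation P p n := {mpoly 'F_p[n]}.

Section Definitions.
Variables p n : nat.

(* The bracket [e_1, ..., e_n].                                                *)
Definition bracket (e : 'I_n -> nat) : P p n :=
  \det (\matrix_(r < n, s < n) ('X_r ^+ (p ^ e s)) : 'M[P p n]_n).

Definition L : P p n := bracket (fun j => j).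

(* [bump s] enumerates 0, 1, 2, ... with s omitted, so on 'I_n its values are  *)
(* 0, ..., s-1, s+1, ..., n when s < n.                                        *)
Definition Lhat (s : nat) : P p n := bracket (fun j => bump s j).

(* Substitution x_r |-> sum_j A_(r,j) x_j.                                     *)
Definition gl_act (A : 'M['F_p]_n) (f : P p n) : P p n :=
  f \mPo [tuple \sum_(j < n) A r j *: 'X_j | r < n].

Definition dickson_algebra : pred (P p n) :=
  fun f => [forall A : 'M['F_p]_n, (A \in unitmx) ==> (gl_act A f == f)].

(* The operation St^(Delta_i) on P_n; [St_linear], [StM], [StX] and            *)
(* [St_unique] below show that it is the only linear derivation sending each   *)
(* x_r to x_r^(p^i).                                                           *)
Definition St (i : nat) (f : P p n) : P p n :=
  \sum_(r < n) f^`M(r) * 'X_r ^+ (p ^ i).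

Lemma St_linear i : linear (St i).
Proof.
move=> a f g; rewrite /St scaler_sumr -big_split /=; apply: eq_bigr => r _.
by rewrite mderivD mderivZ mulrDl scalerAl.
Qed.

Lemma StM i f g : St i (f * g) = St i f * g + f * St i g.
Proof.
rewrite /St mulr_suml mulr_sumr -big_split /=; apply: eq_bigr => r _.
by rewrite mderivM mulrDl -!mulrA [g * _]mulrC.
Qed.

Lemma StX i r : St i 'X_r = 'X_r ^+ (p ^ i).
Proof.
rewrite /St (bigD1 r) //= big1 ?addr0 => [|j jr]; rewrite mderivX mnmE.
  have -> : (U_(r) - U_(r))%MM = 0%MM :> 'X_{1..n}.
    by apply/mnmP => k; rewrite mnmBE mnm0E subnn.
  by rewrite eqxx scale1r mpolyX0 mul1r.
by rewrite eq_sym (negbTE jr) scale0r mul0r.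
Qed.

Lemma St_unique i (D : P p n -> P p n) :
    linear D -> (forall f g, D (f * g) = D f * g + f * D g) ->
    (forall r, D 'X_r = 'X_r ^+ (p ^ i)) ->
  D =1 St i.
Proof.
move=> Dlin DM DX.
have D0 : D 0 = 0.
  by have := Dlin (-1) 0 0; rewrite !scaler0 !addr0 scaleN1r addNr.
have DD f g : D (f + g) = D f + D g by have := Dlin 1 f g; rewrite !scale1r.
have DZ a f : D (a *: f) = a *: D f.
  by have := Dlin a f 0; rewrite D0 !addr0.
have S0 : St i 0 = 0.
  by have := St_linear i (-1) 0 0; rewrite !scaler0 !addr0 scaleN1r addNr.
have D1 : D 1 = 0.
  by have /eqP := DM 1 1; rewrite !mulr1 mul1r -subr_eq0 opprD addNKr oppr_eq0
     => /eqP.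
have S1 : St i 1 = 0.
  by have /eqP := StM i 1 1; rewrite !mulr1 mul1r -subr_eq0 opprD addNKr
     oppr_eq0 => /eqP.
have EM f g : D f = St i f -> D g = St i g -> D (f * g) = St i (f * g).
  by move=> Df Dg; rewrite DM StM Df Dg.
elim/mpolyind=> [|c m f _ _ IH]; first by rewrite D0 S0.
rewrite DD DZ IH St_linear; congr (_ *: _ + _).
rewrite mpolyXE_id; apply: (big_ind (fun f => D f = St i f)) => //.
  by rewrite D1 S1.
move=> r _; elim: (m r) => [|k IHk]; first by rewrite expr0 D1 S1.
by rewrite exprS; apply: EM; rewrite ?DX ?StX.
Qed.

End Definitions.

(* Ore's construction: F_0 = Y and F_(k+1) = F_k^p - F_k(x_(k+1))^(p-1) F_k    *)
(* make F_k a monic p-polynomial of degree p^k that kills x_1, ..., x_k.       *)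
Lemma ppoly_annihilator (p : nat) (R : comNzRingType) (xs : seq R) :
    p \in [pchar R] ->
  exists b : nat -> R, forall y, y \in xs ->
    y ^+ (p ^ size xs) + \sum_(j < size xs) b j * y ^+ (p ^ j) = 0.
Proof.
move=> pR; have p0 := prime_gt0 (pcharf_prime pR).
elim: xs => [|x xs [b bP]]; first by exists (fun=> 0).
set k := size xs in bP *.
pose F y := y ^+ (p ^ k) + \sum_(j < k) b j * y ^+ (p ^ j).
pose c := F x ^+ p.-1.
exists (fun j => (if j is j'.+1 then b j' ^+ p else 0) -
                 c * (if j == k then 1 else b j)) => y yxs.
transitivity (F y ^+ p - c * F y); last first.
  move: yxs; rewrite inE => /predU1P[->|yxs].
    by rewrite /c -exprSr prednK // subrr.
  by rewrite /F bP // mulr0 expr0n gtn_eqF // subrr.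
have FrobE z : z ^+ p = pFrobenius_aut pR z by rewrite pFrobenius_autE.
rewrite /= -/k [in RHS]FrobE rmorphD rmorph_sum /= pFrobenius_autE -exprM -expnSr.
rewrite -addrA; congr (_ + _).
under eq_bigr => j _ do rewrite mulrBl.
rewrite sumrB; congr (_ - _).
  rewrite big_ord_recl mul0r add0r; apply: eq_bigr => j _.
  by rewrite rmorphM /= !pFrobenius_autE -exprM -expnSr.
rewrite big_ord_recr /= eqxx mulr1 mulrDr addrC; congr (_ + _).
rewrite mulr_sumr; apply: eq_bigr => j _.
by rewrite ltn_eqF // mulrA.
Qed.

Section Dickson.
Variables (p n : nat).
Hypothesis p_pr : prime p.

Lemma dickson_exists (s : nat) : exists q : P p n, q * L p n == Lhat p n s.
Proof.
have pR : p \in [pchar (P p n)].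
  by rewrite pchar_lalg pchar_Fp.
have [b] := ppoly_annihilator [seq 'X_i | i : 'I_n] pR.
rewrite size_map -cardE card_ord => bP.
pose C : 'M[P p n]_n := \matrix_(k < n, j < n)
  if (bump s j < n)%N then (k == bump s j :> nat)%:R else - b k.
exists (\det C); apply/eqP; rewrite mulrC /L /Lhat /bracket -det_mulmx.
congr (\det _); apply/matrixP => r j; rewrite !mxE.
under eq_bigr => k _ do rewrite !mxE.
case: ltnP => [lt_n|ge_n].
  rewrite (bigD1 (Ordinal lt_n)) //= eqxx mulr1 big1 ?addr0 // => k.
  by rewrite -val_eqE /= => /negbTE ->; rewrite mulr0.
have -> : bump s j = n.
  apply/eqP; rewrite eqn_leq ge_n andbT /bump.
  by case: (s <= j)%N; rewrite ?add1n ?add0n ?(ltnW (ltn_ord j)).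
have /bP/eqP : 'X_r \in [seq ('X_i : P p n) | i : 'I_n].
  by apply: map_f; rewrite mem_enum.
rewrite addr_eq0 => /eqP ->; rewrite -sumrN; apply: eq_bigr => k _.
by rewrite mulrN mulrC.
Qed.

(* Q_(n,s) = L_(n,s) / L_n; the quotient is unique by [L_neq0].                *)
Definition Q (s : nat) : P p n := xchoose (dickson_exists s).

Lemma QE s : Q s * L p n = Lhat p n s.
Proof. exact/eqP/(xchooseP (dickson_exists s)). Qed.

Lemma L_neq0 : L p n != 0.
Proof.
apply/negP => /eqP /(congr1 (mcoeff [multinom (p ^ (i : nat))%N | i < n])).
rewrite mcoeff0 /L /bracket /determinant raddf_sum (bigD1 1%g) //=.
have prodE (t : {perm 'I_n}) :
    \prod_(i < n) (\matrix_(r < n, j < n) ('X_r ^+ (p ^ j)) : 'M[P p n]_n)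
      i (t i) = 'X_[ [multinom (p ^ (t i : nat))%N | i < n] ].
  by rewrite mpolyXE_id; apply: eq_bigr => i _; rewrite !mxE mnmE.
rewrite [X in _ + X]big1 => [|t t1].
  rewrite addr0 odd_perm1 expr0 mul1r prodE mcoeffX.
  suff -> : [multinom (p ^ ((1%g : {perm 'I_n}) i : nat))%N | i < n]
          = [multinom (p ^ (i : nat))%N | i < n].
    by rewrite eqxx => /eqP; rewrite oner_eq0.
  by apply/mnmP => i; rewrite !mnmE perm1.
rewrite prodE mulr_sign; case: (odd_perm t); rewrite ?mcoeffN mcoeffX;
  case: eqP => [/mnmP E|_]; rewrite ?oppr0 //; case/eqP: t1;
  apply/permP => i; have := E i; rewrite !mnmE perm1 => /eqP;
  by rewrite eqn_exp2l ?prime_gt1 // => /eqP /val_inj.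
Qed.

End Dickson.

Arguments L p n : clear implicits.
Arguments Lhat p n s : clear implicits.
Arguments dickson_algebra p n : clear implicits.
Arguments St p n i f : clear implicits.
Arguments Q p n p_pr s : clear implicits.

(* Main.v *)
(* Write D for St^(Delta_i). In characteristic p the operator D^p is again a
   derivation, and it kills each x_r because D(x_r^(p^i)) = 0; so D^p = 0 on
   all of P_n.
   In a bracket with exactly one zero exponent, D replaces that exponent by i
   (expand along its column); the result is the p-th power of a bracket, hence
   equals L_n^p v^p with v in D_n. So D(L_n) = - L_n^p W and
   D(L_(n,s)) = L_n^p V with W, V p-th powers up to sign (V = 0 when s = 0, as
   L_(n,0) = L_n^p). The quotient rule gives D(Q_s) = Q_0 (V + Q_s W) and
   D(Q_0) = Q_0^2 W, while D(V) = D(W) = 0, whence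
   D^(m+1)(Q_s) = (m+1)! Q_0^(m+1) W^m (V + Q_s W). *)

From HB Require Import structures.
Require Import Defs.
From mathcomp Require Import all_boot all_order all_algebra.
From mathcomp Require Import mpoly ring.

Import GRing.Theory.
Local Open Scope ring_scope.

(** * Iterates of a derivation on a commutative ring *)

Section Derivation.
Variables (R : comNzRingType) (D : R -> R).
Hypothesis DD : {morph D : f g / f + g}.
Hypothesis DM : forall f g, D (f * g) = D f * g + f * D g.

Lemma deriv0 : D 0 = 0.
Proof. by apply: (addrI (D 0)); rewrite -DD !addr0. Qed.

Lemma derivMn f k : D (f *+ k) = D f *+ k.
Proof. by elim: k => [|k IH]; rewrite ?mulr0n ?deriv0 // !mulrSr DD IH. Qed.

Lemma derivX f k : D (f ^+ k) = f ^+ k.-1 * D f *+ k.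
Proof.
elim: k => [|[|k] IH]; rewrite ?mulr1n ?expr0 ?mul1r //.
  rewrite mulr0n; apply: (addrI (D 1)).
  by rewrite addr0 -[in RHS](mulr1 1) DM mulr1 mul1r.
by rewrite exprS DM IH mulrnAr mulrA -exprS [in RHS]mulrS mulrC.
Qed.

Lemma iter_derivM m f g : iter m D (f * g) =
  \sum_(k < m.+1) (iter (m - k) D f * iter k D g) *+ 'C(m, k).
Proof.
elim: m => [|m IH]; first by rewrite big_ord1 mulr1n.
rewrite iterS IH (big_morph D DD deriv0).
transitivity (\sum_(k < m.+1) (iter (m.+1 - k) D f * iter k D g) *+ 'C(m, k)
  + \sum_(k < m.+1) (iter (m - k) D f * iter k.+1 D g) *+ 'C(m, k)).
  rewrite -big_split /=; apply: eq_bigr => k _.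
  by rewrite derivMn DM mulrnDl subSn // -ltnS.
rewrite [in LHS]big_ord_recl [X in _ + X = _]big_ord_recr /=.
rewrite [RHS]big_ord_recl [X in _ = _ + X]big_ord_recr /= /bump /= !add1n.
rewrite !bin0 !binn !subnn -!addrA; congr (_ + _); rewrite addrA.
congr (_ + _); rewrite -big_split /=; apply: eq_bigr => k _.
by rewrite /bump !add1n binS mulrnDr !subSS.
Qed.

(** Put T = V + q W, so that D T = q0 T W. Differentiating q0^(m+1) W^m T gives m+1 copies of
    q0^(m+2) W^(m+1) T from the power of [q0] and one more from T, which turns (m+1)! into
    (m+2)!. *)
Lemma iter_deriv_riccati q0 q V W m :
    D V = 0 -> D W = 0 -> D q0 = q0 * (q0 * W) -> D q = q0 * (V + q * W) ->
  iter m.+1 D q = q0 ^+ m.+1 * (W ^+ m * (V + q * W) *+ (m.+1)`!).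
Proof.
move=> DV DW Dq0 Dq; elim: m => [|m IH]; first by rewrite /= Dq expr1 mul1r.
have DT : D (V + q * W) = q0 * (V + q * W) * W.
  by rewrite DD DM DV DW Dq mulr0 addr0 add0r.
rewrite iterS IH mulrnAr derivMn !DM !derivX Dq0 DW DT mulr0 mul0rn mul0r add0r.
rewrite [X in _ = X]mulrnAr (factS m.+1) [RHS]mulrnA; congr (_ *+ _).
by rewrite mulrnAl [RHS]mulrSr; congr (_ *+ _ + _); rewrite !exprS /=; ring.
Qed.

End Derivation.

(** * Nilpotency of the operation on the whole polynomial ring *)

HB.instance Definition _ (p n i : nat) :=
  GRing.isLinear.Build 'F_p (P p n) (P p n) _ (St p n i) (@St_linear p n i).

Section Frobenius.
Variables (p : nat) (hp : prime p).

Lemma pchar_mpoly n : p \in [pchar (P p n)].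
Proof. by rewrite pchar_lalg pchar_Fp. Qed.

Lemma Fp_expp (a : 'F_p) : a ^+ p = a.
Proof.
by rewrite -[a in LHS]natr_Zp -(pFrobenius_autE (pchar_Fp hp))
  pFrobenius_aut_nat natr_Zp.
Qed.

Lemma St_expp n i (f : P p n) : St p n i (f ^+ p) = 0.
Proof.
rewrite (@derivX _ (St p n i) (@StM p n i)).
by rewrite -mulr_natr pcharf0 ?mulr0 // pchar_mpoly.
Qed.

Lemma iter_St_p n i (f : P p n) : (0 < i)%N -> iter p (St p n i) f = 0.
Proof.
move=> i_gt0; have p_gt0 := prime_gt0 hp.
pose E f := iter p (St p n i) f.
have Elin : linear E.
  suff iterP k : linear (iter k (St p n i)) by exact: iterP.
  by move=> a g h; elim: k => //= k ->; rewrite linearP.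
have EM g h : E (g * h) = E g * h + g * E h.
  rewrite /E (@iter_derivM _ (St p n i) (raddfD (St p n i)) (@StM p n i)).
  (* Only the outer terms k = 0 and k = p of the Leibniz sum survive, since p divides all the other
     binomial coefficients. *)
  rewrite (bigD1 ord0) // (bigD1 ord_max) /=; last by rewrite -val_eqE /= -lt0n.
  rewrite bin0 binn subnn subn0 big1 ?addr0 // => k /andP[k0 kp].
  have /dvdnP[c ->] : (p %| 'C(p, k))%N.
    apply: prime_dvd_bin => //; rewrite lt0n k0 ltn_neqAle kp /=.
    by rewrite -ltnS ltn_ord.
  by rewrite mulrnA -mulr_natr pcharf0 ?mulr0 // pchar_mpoly.
have EX r : E 'X_r = 0.
  have iter0 k : iter k (St p n i) 0 = 0 by elim: k => //= k ->; rewrite raddf0.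
  suff iterX k : (1 < k)%N -> iter k (St p n i) 'X_r = 0.
    exact: iterX (prime_gt1 hp).
  case: k => [|[|k _]] //; rewrite !iterSr StX.
  have -> : (p ^ i = p ^ i.-1 * p)%N by rewrite -expnSr prednK.
  by rewrite exprM St_expp iter0.
(* Adding [E] to [St] gives a linear derivation with the same values on the variables, so
   [St_unique] forces [E] to vanish. *)
have SE g : St p n i g + E g = St p n i g.
  apply: (@St_unique p n i (fun g => St p n i g + E g)) => [a h k|h k|r].
  - by rewrite linearP Elin scalerDr addrACA.
  - by rewrite StM EM mulrDl mulrDr addrACA.
  - by rewrite StX EX addr0.
by apply: (addrI (St p n i f)); rewrite addr0; exact: SE.
Qed.

(** * Brackets: Frobenius, invariance and divisibility by L_n *)

Lemma bracketS n (e : 'I_n -> nat) :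
  bracket p (fun j => (e j).+1) = bracket p e ^+ p.
Proof.
rewrite /bracket -(pFrobenius_autE (pchar_mpoly n)) -det_map_mx.
congr (\det _); apply/matrixP => r j.
by rewrite !mxE /= pFrobenius_autE -exprM -expnSr.
Qed.

Lemma eq_bracket n (e e' : 'I_n -> nat) :
  e =1 e' -> bracket p e = bracket p e'.
Proof.
by move=> eq_e; congr (\det _); apply/matrixP => r j; rewrite !mxE eq_e.
Qed.

(** The point is that [b] does not depend on [r]: the matrix of any bracket then factors through the
    matrix of L_n. *)
Lemma powers_span n k : exists b : nat -> P p n,
  forall r : 'I_n, 'X_r ^+ (p ^ k) = \sum_(j < n) b j * 'X_r ^+ (p ^ j).
Proof.
case: n => [|n]; first by exists (fun=> 0) => -[].
elim: k => [|k [b bE]].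
  exists (fun j => (j == 0)%:R) => r.
  by rewrite big_ord_recl mul1r big1 ?addr0 // => j _; rewrite mul0r.
have [a] := ppoly_annihilator [seq 'X_i | i : 'I_n.+1] (pchar_mpoly n.+1).
rewrite size_map -cardE card_ord => aP.
(* Frobenius shifts the coefficients up by one place; the overflow, at exponent p^(n+1), is folded
   back by the annihilating polynomial. *)
exists (fun j => (if j is j'.+1 then b j' ^+ p else 0) - b n ^+ p * a j) => r.
have /aP/eqP : 'X_r \in [seq ('X_i : P p n.+1) | i : 'I_n.+1].
  by apply: map_f; rewrite mem_enum.
rewrite addr_eq0 => /eqP topE.
rewrite expnSr exprM bE -(pFrobenius_autE (pchar_mpoly n.+1)) rmorph_sum /=.
under eq_bigr => j _ do rewrite pFrobenius_autE exprMn -exprM -expnSr.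
under [RHS]eq_bigr => j _ do rewrite mulrBl.
rewrite sumrB big_ord_recr topE mulrN [in RHS]big_ord_recl mul0r add0r.
congr (_ - _); rewrite mulr_sumr; apply: eq_bigr => j _.
by rewrite mulrA.
Qed.

Lemma dickson_algebraP n (f : P p n) :
  reflect (forall A, A \in unitmx -> gl_act A f = f)
    (f \in dickson_algebra p n).
Proof.
apply: (iffP forallP) => [fP A uA|fP A]; last by apply/implyP => /fP ->.
by have /implyP/(_ uA)/eqP := fP A.
Qed.

(** Frobenius fixes the entries of [A], so the substitution acts on the p^k-th powers of the
    variables through [A] itself, and the bracket matrix is multiplied by [A] on the left. *)
Lemma gl_act_bracket n (A : 'M['F_p]_n) e :
  gl_act A (bracket p e) = \det A *: bracket p e.
Proof.
have actX r k : gl_act A ('X_r ^+ (p ^ k)) = \sum_j A r j *: 'X_j ^+ (p ^ k).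
  elim: k => [|k IH].
    by rewrite !expr1 /gl_act comp_mpolyXU -tnth_nth tnth_mktuple.
  rewrite expnSr exprM /gl_act rmorphXn /= [_ \mPo _]IH.
  rewrite -(pFrobenius_autE (pchar_mpoly n)) rmorph_sum /=.
  apply: eq_bigr => j _.
  by rewrite pFrobenius_autE exprZn Fp_expp -exprM.
rewrite /gl_act /bracket -det_map_mx -mul_mpolyC -(det_map_mx (@mpolyC n _)).
rewrite -det_mulmx; congr (\det _); apply/matrixP => r j.
rewrite !mxE [LHS]actX; apply: eq_bigr => k _.
by rewrite !mxE mul_mpolyC.
Qed.

(** Both brackets are scaled by the same unit det A, which cancels from the quotient. *)
Lemma dickson_quotient n e (f : P p n) :
  f * L p n = bracket p e -> f \in dickson_algebra p n.
Proof.
move=> fL; apply/dickson_algebraP => A uA.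
have : gl_act A (f * L p n) = gl_act A f * (\det A *: L p n).
  by rewrite -gl_act_bracket; apply: rmorphM.
rewrite fL gl_act_bracket -fL -scalerAr => /(scalerI _) fA.
by apply: (mulIf (L_neq0 n hp)); rewrite -fA // -unitfE -unitmxE.
Qed.

Lemma bracket_dvd n e : exists2 f : P p n,
  f \in dickson_algebra p n & f * L p n = bracket p e.
Proof.
suff [f fL] : exists f : P p n, f * L p n = bracket p e.
  by exists f => //; apply: dickson_quotient fL.
have /fin_all_exists[b bE] := fun j => @powers_span n (e j).
exists (\det (\matrix_(k, j) b j k)); rewrite mulrC -det_mulmx.
congr (\det _); apply/matrixP => r j; rewrite !mxE bE.
by apply: eq_bigr => k _; rewrite !mxE mulrC.
Qed.

(** * The operation on brackets and on Dickson invariants *)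

Lemma St_bracket n i (e : 'I_n.+1 -> nat) :
    e ord0 = 0%N -> (forall j, j != ord0 -> (0 < e j)%N) ->
  St p n.+1 i (bracket p e) =
    bracket p (fun j => if j == ord0 then i else e j).
Proof.
move=> e0 e_gt0; rewrite /bracket !(expand_det_col _ ord0) raddf_sum /=.
apply: eq_bigr => r _; rewrite StM !mxE e0 eqxx expr1 StX /=.
rewrite [X in _ + 'X_r * X](_ : _ = 0) ?mulr0 ?addr0.
  congr (_ * (_ * \det _)); apply/matrixP => k j.
  by rewrite !mxE eq_sym (negbTE (neq_lift _ _)).
(* The minors along column zero involve only positive exponents. [N] holds the p-th roots of their
   entries, so each cofactor is, up to sign, a p-th power and is killed. *)
pose N : 'M[P p n.+1]_n :=
  \matrix_(k, j) 'X_(lift r k) ^+ (p ^ (e (lift ord0 j)).-1).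
rewrite /cofactor -signr_odd mulr_sign.
rewrite (_ : row' r (col' ord0 _) =
             map_mx (pFrobenius_aut (pchar_mpoly n.+1)) N).
  rewrite det_map_mx /= pFrobenius_autE.
  by case: ifP; rewrite ?raddfN /= St_expp ?oppr0.
apply/matrixP => k j; rewrite !mxE /= pFrobenius_autE -exprM -expnSr prednK //.
by rewrite e_gt0 // eq_sym neq_lift.
Qed.

Lemma St_bracket_dvd n i (e : 'I_n.+1 -> nat) : (0 < i)%N ->
    e ord0 = 0%N -> (forall j, j != ord0 -> (0 < e j)%N) ->
  exists2 v, v \in dickson_algebra p n.+1 &
    St p n.+1 i (bracket p e) = L p n.+1 ^+ p * v ^+ p.
Proof.
move=> i_gt0 e0 e_gt0; rewrite St_bracket //.
(* All the new exponents are positive, so lowering each by one extracts a p-th root of the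
   bracket. *)
have [v vD vL] := bracket_dvd n.+1 (fun j => (if j == ord0 then i else e j).-1).
exists v; first exact: vD.
rewrite -exprMn [X in X ^+ _]mulrC vL -bracketS; apply: eq_bracket => j.
by case: ifPn => [_|/e_gt0 ej_gt0]; rewrite prednK.
Qed.

Lemma St_Lhat n i s : (0 < i)%N -> exists2 v, v \in dickson_algebra p n.+1 &
  St p n.+1 i (Lhat p n.+1 s) = L p n.+1 ^+ p * v ^+ p.
Proof.
move=> i_gt0; case: s => [|s].
  exists 0; first by apply/dickson_algebraP => A _; apply: raddf0.
  by rewrite [Lhat _ _ _]bracketS St_expp expr0n gtn_eqF ?mulr0 // prime_gt0.
(* For a positive omitted index, exponent 0 still occurs in column zero and only there. *)
apply: St_bracket_dvd => // j j0; rewrite /bump.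
by rewrite addn_gt0 [X in _ || X]lt0n [_ != _]j0 orbT.
Qed.

(** Quotient rule with L_n cancelled: Q_0 appears because L_n^p = L_(n,0) = Q_0 L_n. *)
Lemma St_quotient {n i} {f U V : P p n.+1} :
    St p n.+1 i (L p n.+1) = L p n.+1 ^+ p * U ->
    St p n.+1 i (f * L p n.+1) = L p n.+1 ^+ p * V ->
  St p n.+1 i f = Q p n.+1 hp 0 * (V - f * U).
Proof.
move=> LU; rewrite StM LU => /(canRL (addrK _)) E.
apply: (mulIf (L_neq0 n.+1 hp)); rewrite E mulrAC QE [Lhat _ _ _]bracketS.
by rewrite mulrBr; congr (_ - _); exact: mulrCA.
Qed.

Lemma iter_St_Q n i s m : (0 < i)%N ->
  exists2 g : P p n.+1, g \in dickson_algebra p n.+1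
    & iter m.+1 (St p n.+1 i) (Q p n.+1 hp s) = Q p n.+1 hp 0 ^+ m.+1 * g.
Proof.
move=> i_gt0; have [v vD St_s] := @St_Lhat n i s i_gt0.
have [u uD St_L] : exists2 u, u \in dickson_algebra p n.+1 &
    St p n.+1 i (L p n.+1) = L p n.+1 ^+ p * u ^+ p.
  by apply: St_bracket_dvd => // j; rewrite lt0n.
have St_0 : St p n.+1 i (Lhat p n.+1 0) = L p n.+1 ^+ p * 0.
  by rewrite [Lhat _ _ _]bracketS St_expp mulr0.
(* The cofactor in [iter_deriv_riccati] for V = v^p and W = -u^p; both are constants of the
   derivation, being p-th powers up to sign. *)
exists ((- u ^+ p) ^+ m * (v ^+ p + Q p n.+1 hp s * (- u ^+ p)) *+ (m.+1)`!).
  apply/dickson_algebraP => A uA.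
  have /dickson_algebraP/(_ A uA) actQ :
      Q p n.+1 hp s \in dickson_algebra p n.+1.
    by apply: (@dickson_quotient _ (fun j => bump s j)); exact: QE.
  move/dickson_algebraP/(_ A uA): uD; move/dickson_algebraP/(_ A uA): vD.
  move: actQ; rewrite /gl_act => actQ actv actu.
  rewrite rmorphMn rmorphM rmorphXn rmorphD rmorphM rmorphN !rmorphXn /=.
  by rewrite actQ actv actu.
apply: (@iter_deriv_riccati _ (St p n.+1 i)).
- exact: raddfD.
- exact: StM.
- exact: St_expp.
- by rewrite raddfN /= St_expp oppr0.
- have -> := St_quotient St_L (etrans (congr1 _ (QE n.+1 hp 0)) St_0).
  by rewrite sub0r -mulrN.
- have -> := St_quotient St_L (etrans (congr1 _ (QE n.+1 hp s)) St_s).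
  by rewrite -mulrN.
Qed.

End Frobenius.

Theorem corollary2p12 (p : nat) (hp : prime p) (p_odd : odd p)
    (n : nat) (n_gt0 : (0 < n)%N) (i : nat) (i_gt0 : (0 < i)%N) :
  [/\ forall m s : nat, (0 < m)%N -> (s < n)%N ->
        exists2 g : P p n, g \in dickson_algebra p n
          & iter m (St p n i) (Q p n hp s) = Q p n hp 0 ^+ m * g,
      forall m s : nat, (p <= m)%N -> (s < n)%N ->
        iter m (St p n i) (Q p n hp s) = 0,
      forall f : P p n, f \in dickson_algebra p n ->
        iter p (St p n i) f = 0
    & forall m : nat, (p <= m)%N ->
        forall f : P p n, f \in dickson_algebra p n ->
          iter m (St p n i) f = 0].
Proof.
have iter_ge m f : (p <= m)%N -> iter m (St p n i) f = 0.
  by move=> /subnKC <-; rewrite iterD iter_St_p.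
split=> [|m s le_pm _|f _|m le_pm f _]; [|exact: iter_ge..].
by case: n n_gt0 {iter_ge} => // n' _ [] // m s _ _; apply: iter_St_Q.
Qed.
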